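(* Let $\mathcal{G}$ be a compact group acting continuously on a sample space $\mathcal{Y}$, and let $T : \mathcal{Y} \to [0,\infty)$ be a measurable statistic with $0 < \mathbb{E}_{\overline{G}}[T(\overline{G}y)] < \infty$ for every $y \in \mathcal{Y}$. Let $M \geq 1$, let $\overline{G}^{(1)}, \dots, \overline{G}^{(M)}$ be i.i.d. $\mathrm{Unif}(\mathcal{G})$, independent of the data, let $\overline{G}^{(0)} = I$ be the identity, and define the Monte Carlo e-value $$\varepsilon_T^M(y) = \frac{T(y)}{\frac{1}{M+1}\sum_{i=0}^M T(\overline{G}^{(i)}y)},$$ with $\varepsilon_T^M(y) = 1$ if the denominator is zero. Then $\varepsilon_T^M$ is exact in expectation over the Monte Carlo samples: $$\mathbb{E}_{\overline{G}^{(1)}, \dots, \overline{G}^{(M)}}\, \mathbb{E}^{\mathrm{Unif}(O)}[\varepsilon_T^M] = 1 \quad \text{for every orbit } O \in \mathcal{Y}/\mathcal{G}.$$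
   Context: All spaces are second-countable locally compact Hausdorff, equipped with their Borel $\sigma$-algebras. $\mathrm{Unif}(\mathcal{G})$ is the Haar probability measure on $\mathcal{G}$, and $\overline{G} \sim \mathrm{Unif}(\mathcal{G})$. The orbit of $y$ is $O_y = \{Gy : G \in \mathcal{G}\}$, and $\mathcal{Y}/\mathcal{G}$ is the set of orbits. $\mathrm{Unif}(O)$ is the law of $\overline{G}y$ for any $y \in O$ (the unique $\mathcal{G}$ invariant probability on $O$). *)

(* Defs.v *)
From HB Require Import structures.
From mathcomp Require Export all_boot all_order all_algebra.
From mathcomp Require Export all_classical all_reals all_analysis.

Set Implicit Arguments.
Unset Strict Implicit.
Unset Printing Implicit Defensive.

Import Order.TTheory GRing.Theory Num.Theory.
Local Open Scope classical_set_scope.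
Local Open Scope ring_scope.

Definition lcsch_space (T : topologicalType) : Prop :=
  [/\ @second_countable T, locally_compact [set: T] & hausdorff_space T].

Notation borel T := (g_sigma_algebraType (@open T)).

HB.mixin Record isTopologicalGroup G of PointedTopological G & Group G := {
  mulg_continuous : continuous (fun p : G * G => (p.1 * p.2)%g) ;
  invg_continuous : continuous (fun x : G => (x^-1)%g)
}.

#[short(type="topologicalGroupType")]
HB.structure Definition TopologicalGroup :=
  {G of PointedTopological G & Group G & isTopologicalGroup G}.

Record continuous_action (G : topologicalGroupType) (Y : ptopologicalType) := {
  act :> G -> Y -> Y ;
  act1 : forall y, act 1%g y = y ;
  actM : forall g h y, act (g * h)%g y = act g (act h y) ;
  act_continuous : continuous (fun p : G * Y => act p.1 p.2)
}.

(* Radon regularity is automatic for finite Borel measures on second-countable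
   locally compact Hausdorff spaces, so translation invariance suffices. *)
Definition haar_probability (R : realType) (G : topologicalGroupType)
    (mu : probability (borel G) R) : Prop :=
  forall (g : G) (A : set (borel G)), measurable A ->
    mu [set (g * x)%g | x in A] = mu A.

Definition mutually_independent (R : realType) (d d' : measure_display)
    (Omega : measurableType d) (S : measurableType d') (P : probability Omega R)
    (I : finType) (X : I -> {RV P >-> S}) : Prop :=
  forall (J : {set I}) (A : I -> set S), (forall i, measurable (A i)) ->
    P (\bigcap_(i in [set` J]) (X i @^-1` A i)) =
    (\prod_(i in J) P (X i @^-1` A i))%E.

Definition iid_with_law (R : realType) (d d' : measure_display)
    (Omega : measurableType d) (S : measurableType d') (P : probability Omega R)
    (I : finType) (X : I -> {RV P >-> S}) (mu : probability S R) : Prop :=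
  mutually_independent X /\
  forall i (A : set S), measurable A -> distribution P (X i) A = mu A.

Section orbits.
Context (G : topologicalGroupType) (Y : ptopologicalType).
Variable a : continuous_action G Y.

Definition act_orbit (y : Y) : set Y := [set a g y | g in [set: G]].

Definition orbit_space : set (set Y) := [set act_orbit y | y in [set: Y]].

Definition orbit_map (y : Y) : borel G -> borel Y := fun g => a g y.

Lemma orbit_map_continuous y : continuous (fun g : G => a g y).
Proof.
move=> g; apply: (@continuous_comp _ _ _ (fun g => (g, y))
  (fun p : G * Y => a p.1 p.2)); last exact: act_continuous.
by apply: (@cvg_pair _ _ _ _ (nbhs g) (nbhs y)) => //=; exact: cvg_cst.
Qed.

Lemma measurable_orbit_map y : measurable_fun [set: borel G] (orbit_map y).
Proof.
apply: (@measurability _ _ (borel G) (borel Y) _ _ (@open Y)) => //.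
move=> _ [U oU <-]; rewrite setTI; apply: sub_sigma_algebra.
by move/continuousP: (@orbit_map_continuous y); exact.
Qed.

HB.instance Definition _ y :=
  isMeasurableFun.Build _ _ _ _ (orbit_map y) (@measurable_orbit_map y).

End orbits.

(* The law of g y for g ~ mu: with mu the Haar probability this is Unif(O) for
   the orbit O of y, and it does not depend on the choice of y in O. *)
Definition orbit_unif (R : realType) (G : topologicalGroupType)
    (Y : ptopologicalType) (a : continuous_action G Y)
    (mu : probability (borel G) R) (y : Y) : probability (borel Y) R :=
  distribution mu (orbit_map a y).

(* The sample g_1, ..., g_M extended by g_0 = 1; index 0 of 'I_M.+1 is ord0. *)
Definition with_identity (G : topologicalGroupType) (M : nat) (g : 'I_M -> G)
    (i : 'I_M.+1) : G :=
  if unlift ord0 i is Some j then g j else 1%g.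

Definition mc_evalue (R : realType) (G : topologicalGroupType)
    (Y : ptopologicalType) (a : continuous_action G Y) (T : Y -> R) (M : nat)
    (g : 'I_M -> G) (y : Y) : R :=
  let avg := (M.+1%:R)^-1 * \sum_(i < M.+1) T (a (with_identity g i) y) in
  if avg == 0 then 1 else T y / avg.

(* Main.v *)
From HB Require Import structures.
Require Import Defs.
From mathcomp Require Import all_boot all_order all_algebra.
From mathcomp Require Import all_classical all_reals all_analysis.
From mathcomp Require Import perm measurable_realfun.

Import Order.TTheory GRing.Theory Num.Theory.
Local Open Scope classical_set_scope.
Local Open Scope ring_scope.

(** Averaging over an orbit is averaging [a h y0] over a Haar element [h], so
    the quantity to compute is the expectation of
    [T (a h y0) / mean (T (a (G_0 * h) y0), ..., T (a (G_M * h) y0))], where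
    [G_0 = 1] and [h], [G_1], ..., [G_M] are independent.  Once [h] is fixed,
    right invariance of the Haar probability makes the [G_j * h], [1 <= j],
    independent Haar elements again; hence [h, G_1 * h, ..., G_M * h] are i.i.d.
    ([translated_law_box]) and in particular exchangeable
    ([iid_exchangeable]).  Dividing each of the M + 1 values by their common
    mean gives M + 1 ratios which add up to M + 1, including when the mean
    vanishes, as every ratio is then 1 by convention.  By exchangeability
    they have the same expectation, which is therefore 1
    ([integral_ratio_to_mean_exchangeable]).

    Two facts about the group support this.  A Haar probability is given as
    left invariant only; right invariance ([haar_right]) comes from invariance
    under inversion ([haar_inv]), a Fubini argument.  Fubini needs
    multiplication to be measurable for the product of the Borel
    sigma-algebras, which second countability provides
    ([measurable_continuous2]). *)

Lemma integral_cst_probability d (S : measurableType d) (R : realType)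
    (P : probability S R) (c : \bar R) : (\int[P]_x c = c)%E.
Proof. by rewrite integral_cst// -[RHS]mule1; congr (_ * _)%E; exact: probability_setT. Qed.

(** * Borel sets of products *)

(** With countable bases, an open set of the product is a countable union of
    open rectangles; without them it may fail to be in the product
    sigma-algebra. *)
Lemma measurable_open_prod (X Y : ptopologicalType) (W : set (X * Y)) :
  @second_countable X -> @second_countable Y -> open W ->
  measurable (W : set (borel X * borel Y)).
Proof.
move=> [BX cBX [oBX nBX]] [BY cBY [oBY nBY]] oW.
pose I := {p : set X * set Y | BX p.1 /\ BY p.2 /\ p.1 `*` p.2 `<=` W}.
have -> : W = \bigcup_(i : I) ((sval i).1 `*` (sval i).2).
  apply/seteqP; split; last by move=> z [[p [? [? pW]]] _] /pW.
  move=> [x y] Wxy.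
  have [[U V] /= [Ux Vy] UVW] : nbhs (x, y) W by exact: open_nbhs_nbhs.
  have [U' [BU' U'x] U'U] := nBX x U Ux.
  have [V' [BV' V'y] V'V] := nBY y V Vy.
  suff UV'W : U' `*` V' `<=` W.
    by exists (exist _ (U', V') (conj BU' (conj BV' UV'W))).
  by move=> z [/U'U ? /V'V ?]; apply: UVW.
apply: countable_bigcupT_measurable.
  have /countable_injP[f injf] := countableX cBX cBY.
  apply/countable_injP; exists (f \o sval).
  move=> [p [pX [pY pW]]] [q [qX [qY qW]]] _ _ /= /injf pq.
  by apply: eq_exist; apply: pq; exact/mem_set.
move=> [[U V] /= [BU [BV _]]]; apply: measurableX; apply: sub_sigma_algebra.
  exact: oBX.
exact: oBY.
Qed.

Lemma measurable_continuous {X Y : ptopologicalType} {f : X -> Y} :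
  continuous f -> measurable_fun [set: borel X] (f : borel X -> borel Y).
Proof.
move=> /continuousP cf.
apply: (@measurability _ _ (borel X) (borel Y) _ _ (@open Y)) => //.
by move=> _ [U oU <-]; rewrite setTI; apply: sub_sigma_algebra; exact: cf.
Qed.

Lemma measurable_continuous2 (X Y Z : ptopologicalType) (f : X * Y -> Z) :
  @second_countable X -> @second_countable Y -> continuous f ->
  measurable_fun [set: borel X * borel Y] (f : borel X * borel Y -> borel Z).
Proof.
move=> sX sY /continuousP cf.
apply: (@measurability _ _ _ (borel Z) _ _ (@open Z)) => //.
by move=> _ [U oU <-]; rewrite setTI; apply: measurable_open_prod => //; exact: cf.
Qed.

(** * Invariance of the Haar probability *)

Section haar.
Context {R : realType} {G : topologicalGroupType} {mu : probability (borel G) R}.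
Hypothesis (hmu : haar_probability mu).

Lemma measurable_mulg : @second_countable G ->
  measurable_fun [set: borel G * borel G]
    (fun p : borel G * borel G => (p.1 * p.2 : G)%g : borel G).
Proof.
move=> sG; apply: (@measurable_continuous2 _ _ _ (fun p : G * G => (p.1 * p.2)%g)) => //.
exact: mulg_continuous.
Qed.

Lemma measurable_invg :
  measurable_fun [set: borel G] (fun x : borel G => (x^-1 : G)%g : borel G).
Proof. exact: (measurable_continuous (@invg_continuous G)). Qed.

Lemma haar_left (g : G) {A : set (borel G)} : measurable A ->
  mu [set x | A (g * x)%g] = mu A.
Proof.
move=> mA; rewrite -(hmu g^-1%g A mA); congr (mu _).
apply/seteqP; split=> [x Agx|_ [x Ax <-]] /=; first by exists (g * x)%g => //; rewrite mulKg.
by rewrite mulVKg.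
Qed.

(** Integrate the indicator of [A] at [x^-1 * y]: translating [y] by [x^-1]
    first yields the measure of [A], while translating [x] by [y] first yields
    the measure of the inverse of [A]. *)
Lemma haar_inv (sG : @second_countable G) {A : set (borel G)} : measurable A ->
  mu [set x | A (x^-1)%g] = mu A.
Proof.
move=> mA.
pose q (p : borel G * borel G) : borel G := (p.1^-1 * p.2 : G)%g.
have mq : measurable_fun [set: borel G * borel G] q.
  pose r (p : borel G * borel G) : borel G * borel G := ((p.1^-1 : G)%g, p.2).
  have mr : measurable_fun [set: borel G * borel G] r.
    apply: measurable_fun_pair; last exact: measurable_snd.
    exact: measurableT_comp measurable_invg measurable_fst.
  exact: (measurableT_comp (measurable_mulg sG) mr).
have mf : measurable_fun setT (fun p => (\1_A (q p) : R)%:E).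
  by apply/measurable_EFinP; apply: measurableT_comp mq; exact: measurable_indic.
have mqx x : measurable_fun [set: borel G] (fun y : borel G => q (x, y)).
  exact: measurable_fun_pair2 mq.
have mqy y : measurable_fun [set: borel G] (fun x : borel G => q (x, y)).
  exact: measurable_fun_pair1 mq.
have integral_q (h : borel G -> borel G) : measurable_fun setT h ->
    (\int[mu]_x (\1_A (h x) : R)%:E = mu (h @^-1` A))%E.
  move=> mh; rewrite -[in RHS](setIT (h @^-1` A)) -integral_indic//.
  by rewrite -[X in measurable X]setTI; exact: mh.
have := @fubini_tonelli _ _ _ _ _ mu mu _ mf (fun p => ltac:(by rewrite lee_fin)).
under eq_integral => x _.
  rewrite integral_q//.
  have -> : (fun y : borel G => q (x, y)) @^-1` A =
      [set y : borel G | A (x^-1 * y : G)%g] by [].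
  rewrite haar_left//; over.
under [RHS]eq_integral => y _.
  rewrite integral_q//.
  rewrite -(haar_left y); last by rewrite -[X in measurable X]setTI; exact: mqy.
  rewrite (_ : [set x | _] = [set x | A (x^-1)%g]); last first.
    by apply/seteqP; split=> x /=; rewrite /q /= invgM mulgVK.
  over.
by rewrite !integral_cst_probability.
Qed.

(** Inversion exchanges right and left translations. *)
Lemma haar_right (sG : @second_countable G) (h : G) {A : set (borel G)} : measurable A ->
  mu [set x | A (x * h)%g] = mu A.
Proof.
move=> mA.
have mAV : measurable [set x : borel G | A (x^-1)%g].
  by rewrite -[X in measurable X]setTI; exact: measurable_invg.
have mAh : measurable [set x : borel G | A (x * h)%g].
  rewrite -[X in measurable X]setTI.
  exact: (measurable_fun_pair1 (h : borel G) (measurable_mulg sG)).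
rewrite -(haar_inv sG mAh) -(haar_inv sG mA) -(haar_left (h^-1)%g mAV).
by congr (mu _); apply/seteqP; split=> x /=; rewrite invgM invgK.
Qed.

End haar.
(** * Laws of tuples and exchangeability *)

Definition box {S : Type} {n : nat} (A : 'I_n -> set S) : set (n.-tuple S) :=
  [set t | forall i, A i (tnth t i)].

Lemma measurable_box d (S : measurableType d) n (A : 'I_n -> set S) :
  (forall i, measurable (A i)) -> measurable (box A).
Proof.
move=> mA.
have -> : box A = \bigcap_(i in [set: 'I_n]) ((fun t : n.-tuple S => tnth t i) @^-1` A i).
  by apply/seteqP; split=> [t At i _|t At i] /=; [exact: At|exact: (At i)].
apply: fin_bigcap_measurable => [|i _]; first exact: finite_finset.
by rewrite -[X in measurable X]setTI; exact: (measurable_tnth (T := S) i).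
Qed.

(** Boxes are stable under intersection and generate the product
    sigma-algebra. *)
Lemma tuple_law_unique d (S : measurableType d) (R : realType) n
    (m1 m2 : probability (n.-tuple S) R) :
  (forall A : 'I_n -> set S, (forall i, measurable (A i)) ->
    m1 (box A) = m2 (box A)) ->
  forall B : set (n.-tuple S), measurable B -> m1 B = m2 B.
Proof.
move=> m12.
pose boxes := [set box A | A in [set A : 'I_n -> set S | forall i, measurable (A i)]].
have boxesT : boxes setT.
  exists (fun=> setT); first by move=> i; exact: measurableT.
  by apply/seteqP; split.
apply: (measure_unique boxes (fun=> setT)) => //.
- apply/seteqP; split.
  + apply: smallest_sub; first exact: smallest_sigma_algebra.
    move=> B; rewrite -bigcup_seq => -[i _ [A mA <-]].
    apply: sub_sigma_algebra; exists (fun j => if j == i then A else setT).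
      by move=> j /=; case: ifP => // _; exact: measurableT.
    rewrite setTI; apply/seteqP; split=> t /=.
      by move/(_ i); rewrite eqxx.
    by move=> At j; case: ifPn => // /eqP ->.
  + apply: smallest_sub; first exact: sigma_algebra_measurable.
    by move=> _ [A mA <-]; exact: measurable_box.
- move=> _ _ [A mA <-] [B mB <-]; exists (fun i => A i `&` B i).
    by move=> i; exact: measurableI.
  apply/seteqP; split=> t /=; first by move=> h; split=> i; case: (h i).
  by move=> [At Bt] i; split.
- by rewrite bigcup_const.
- by move=> _ [A mA <-]; exact: m12.
- by move=> _; apply: (le_lt_trans (probability_le1 _ _)) => //; rewrite ?ltry.
Qed.

Definition permute_tuple {S : Type} {n : nat} (s : 'S_n) (t : n.-tuple S) : n.-tuple S :=
  [tuple tnth t (s i) | i < n].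

Lemma measurable_permute_tuple d (S : measurableType d) n (s : 'S_n) :
  measurable_fun [set: n.-tuple S] (permute_tuple s : n.-tuple S -> n.-tuple S).
Proof.
apply/measurable_fun_tnthP => i.
rewrite (_ : _ \o _ = (fun t : n.-tuple S => tnth t (s i))).
  exact: (measurable_tnth (T := S)).
by apply/funext => t /=; rewrite tnth_mktuple.
Qed.

HB.instance Definition _ d (S : measurableType d) n (s : 'S_n) :=
  isMeasurableFun.Build _ _ _ _ (permute_tuple s : n.-tuple S -> n.-tuple S)
    (measurable_permute_tuple _ S _ s).

Lemma iid_exchangeable d (S : measurableType d) (R : realType) n
    (mu : probability S R) (nu : probability (n.-tuple S) R) (s : 'S_n) :
  (forall A : 'I_n -> set S, (forall i, measurable (A i)) ->
    nu (box A) = (\prod_(i < n) mu (A i))%E) ->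
  forall B : set (n.-tuple S), measurable B ->
    nu (permute_tuple s @^-1` B) = nu B.
Proof.
move=> nuE.
apply: (@tuple_law_unique _ _ _ _ (distribution nu (permute_tuple s)) nu) => A mA.
rewrite [LHS](_ : _ = nu (box (fun i => A ((s^-1)%g i)))); last first.
  congr (nu _); apply/seteqP; split=> t /= h i.
    by have := h (s^-1 i)%g; rewrite tnth_mktuple permKV.
  by rewrite tnth_mktuple -{1}(permK s i); exact: h.
rewrite !nuE// (reindex_inj (@perm_inj _ s)) /=.
by apply: eq_bigr => i _; rewrite permK.
Qed.
(** * Ratios of exchangeable values to their mean *)

Section ratio_to_mean.
Context {R : realType} {d} {S : measurableType d} (f : S -> R) {n : nat}.
Implicit Types (t : n.+1.-tuple S) (i : 'I_n.+1).

Definition mean (t : n.+1.-tuple S) : R :=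
  (n.+1%:R)^-1 * \sum_(j < n.+1) f (tnth t j).

(** The convention at a zero mean keeps the sum of the ratios equal to their
    number. *)
Definition ratio_to_mean i t : R := if mean t == 0 then 1 else f (tnth t i) / mean t.

Lemma sum_ratio_to_mean t : \sum_(i < n.+1) ratio_to_mean i t = n.+1%:R.
Proof.
rewrite /ratio_to_mean; have [_|m0] := eqVneq (mean t) 0; first by rewrite sumr_const card_ord.
rewrite -mulr_suml; apply: (mulIf m0); rewrite mulfVK//.
by rewrite /mean mulrA mulfV ?mul1r// pnatr_eq0.
Qed.

Lemma ratio_to_mean_permute (s : 'S_n.+1) i t :
  ratio_to_mean i (permute_tuple s t) = ratio_to_mean (s i) t.
Proof.
suff mean_permute : mean (permute_tuple s t) = mean t.
  by rewrite /ratio_to_mean mean_permute tnth_mktuple.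
rewrite /mean; congr (_ * _); apply/esym; rewrite (reindex_inj (@perm_inj _ s)) /=.
by apply: eq_bigr => j _; rewrite tnth_mktuple.
Qed.

Hypothesis f_ge0 : forall x, 0 <= f x.

Lemma mean_ge0 t : 0 <= mean t.
Proof. by rewrite mulr_ge0 ?invr_ge0// sumr_ge0. Qed.

Lemma ratio_to_mean_ge0 i t : 0 <= ratio_to_mean i t.
Proof. by rewrite /ratio_to_mean; case: ifPn => // _; rewrite divr_ge0 ?mean_ge0. Qed.

Hypothesis mf : measurable_fun [set: S] f.

Lemma measurable_mean : measurable_fun [set: n.+1.-tuple S] mean.
Proof.
apply: measurable_funM => //; apply: measurable_sum => j.
exact: (measurableT_comp mf (measurable_tnth (T := S) j)).
Qed.

Lemma measurable_ratio_to_mean i : measurable_fun [set: n.+1.-tuple S] (ratio_to_mean i).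
Proof.
(* On nonnegative reals inversion is a power function, hence measurable. *)
have mean_inv : (fun t => (mean t)^-1) = (fun t => mean t `^ (-1)).
  by apply/funext => t; rewrite powR_inv1// mean_ge0.
apply: measurable_fun_ifT => //.
  by apply: measurable_fun_eqr => //; exact: measurable_mean.
apply: (measurable_funM (g := fun t => (mean t)^-1)).
  exact: (measurableT_comp mf (measurable_tnth (T := S) i)).
rewrite mean_inv.
exact: (measurableT_comp (@measurable_powR R (-1)) measurable_mean).
Qed.

(** Swapping two coordinates shows that all the ratios have the same integral,
    and the n + 1 integrals add up to n + 1. *)
Lemma integral_ratio_to_mean_exchangeable (nu : probability (n.+1.-tuple S) R) i :
  (forall (s : 'S_n.+1) (B : set (n.+1.-tuple S)), measurable B ->
    nu (permute_tuple s @^-1` B) = nu B) ->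
  (\int[nu]_t (ratio_to_mean i t)%:E = 1)%E.
Proof.
move=> exch.
have mratio j : measurable_fun [set: n.+1.-tuple S] (fun t => (ratio_to_mean j t)%:E).
  by apply/measurable_EFinP; exact: measurable_ratio_to_mean.
have ratio_eq j : (\int[nu]_t (ratio_to_mean j t)%:E = \int[nu]_t (ratio_to_mean i t)%:E)%E.
  transitivity (\int[distribution nu (permute_tuple (tperm i j))]_t (ratio_to_mean i t)%:E)%E.
    rewrite ge0_integral_distribution//; last by move=> t; rewrite lee_fin ratio_to_mean_ge0.
    by apply: eq_integral => t _ /=; rewrite ratio_to_mean_permute tpermL.
  by apply: eq_measure_integral => B mB _; exact: exch.
have : (\sum_(j < n.+1) \int[nu]_t (ratio_to_mean j t)%:E = n.+1%:R%:E)%E.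
  rewrite -ge0_integral_sum//; last by move=> j t _; rewrite lee_fin ratio_to_mean_ge0.
  under eq_integral do rewrite sumEFin sum_ratio_to_mean.
  exact: integral_cst_probability.
have -> : (\sum_(j < n.+1) \int[nu]_t (ratio_to_mean j t)%:E =
    n.+1%:R%:E * \int[nu]_t (ratio_to_mean i t)%:E)%E.
  rewrite -[X in (X%:R)%:E](card_ord n.+1) -sumr_const -sumEFin ge0_sume_distrl//.
  by apply: eq_bigr => j _; rewrite mul1e.
move=> sum1.
rewrite -[LHS]mul1e -(@mulVf _ (n.+1%:R : R)) ?pnatr_eq0// EFinM -muleA sum1.
by rewrite -EFinM mulVf ?pnatr_eq0.
Qed.
End ratio_to_mean.
(** * The translated sample *)

Section translated_sample.
Context {R : realType} {G : topologicalGroupType} (mu : probability (borel G) R).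
Context {M : nat} {d} {Omega : measurableType d} {P : probability Omega R}.
Variable Gs : 'I_M -> {RV P >-> borel G}.
Hypotheses (sG : @second_countable G) (hmu : haar_probability mu).
Hypothesis (hGs : iid_with_law Gs mu).

(** For [p = (w, h)] this is [h, G_1 * h, ..., G_M * h]: the base point of the
    orbit moved by [h], followed by its Monte Carlo resamples. *)
Definition translated_sample (p : Omega * borel G) : M.+1.-tuple (borel G) :=
  [tuple (with_identity (fun j => Gs j p.1) i * p.2 : G)%g | i < M.+1].

Lemma measurable_translated_sample :
  measurable_fun [set: Omega * borel G] translated_sample.
Proof.
apply/measurable_fun_tnthP => i.
pose r (p : Omega * borel G) : borel G * borel G :=
  (with_identity (fun j => Gs j p.1) i, p.2).
rewrite (_ : _ \o _ = (fun q : borel G * borel G => (q.1 * q.2 : G)%g : borel G) \o r);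
  last by apply/funext => p /=; rewrite tnth_mktuple.
have mr : measurable_fun [set: Omega * borel G] r.
  apply: measurable_fun_pair; last exact: measurable_snd.
  rewrite /with_identity; case: (unlift ord0 i) => [j|]; last exact: measurable_cst.
  exact: (measurableT_comp (measurable_funPT (Gs j)) measurable_fst).
exact: (measurableT_comp (measurable_mulg sG) mr).
Qed.

HB.instance Definition _ :=
  isMeasurableFun.Build _ _ _ _ translated_sample measurable_translated_sample.

Definition translated_law : probability (M.+1.-tuple (borel G)) R :=
  distribution (P \x mu)%E translated_sample.

Lemma integral_translated_law (F : M.+1.-tuple (borel G) -> \bar R) :
  measurable_fun [set: M.+1.-tuple (borel G)] F -> (forall t, 0 <= F t)%E ->
  (\int[translated_law]_t F t =
   \int[P]_w \int[mu]_h F (translated_sample (w, h)))%E.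
Proof.
move=> mF F_ge0; rewrite ge0_integral_distribution// fubini_tonelli1//.
  exact: (measurableT_comp mF measurable_translated_sample).
by move=> p; exact: F_ge0.
Qed.

Lemma sample_rectangle (A : 'I_M -> set (borel G)) :
  (forall j, measurable (A j)) ->
  P [set w | forall j, A j (Gs j w)] = (\prod_(j < M) mu (A j))%E.
Proof.
move=> mA; have [indep law] := hGs.
transitivity (P (\bigcap_(i in [set` [set: 'I_M]%SET]) (Gs i @^-1` A i))).
  congr (P _); apply/seteqP; split=> w /= h j; first by move=> _; exact: h.
  by apply: h; rewrite /= inE.
rewrite indep//; apply: eq_big => [j|j _]; first by rewrite inE.
exact: law.
Qed.

(** Condition on [h]: the event is that [h] lies in the first side and every
    [G_j] in a right translate by [h^-1] of its side.  Right invariance makes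
    the conditional probability of the latter independent of [h]. *)
Lemma translated_law_box (A : 'I_M.+1 -> set (borel G)) :
  (forall i, measurable (A i)) ->
  translated_law (box A) = (\prod_(i < M.+1) mu (A i))%E.
Proof.
move=> mA.
have mE : measurable (translated_sample @^-1` box A).
  rewrite -[X in measurable X]setTI; apply: measurable_translated_sample => //.
  exact: measurable_box.
transitivity (\int[(P \x mu)%E]_p (\1_(translated_sample @^-1` box A) p : R)%:E)%E.
  by rewrite integral_indic// setIT.
rewrite fubini_tonelli2 /=; last 2 first.
- by apply/measurable_EFinP; exact: measurable_indic.
- by move=> p; rewrite lee_fin.
transitivity (\int[mu]_h ((\1_(A ord0) h : R)%:E * \prod_(j < M) mu (A (lift ord0 j))))%E.
  apply: eq_integral => h _; rewrite /fubini_G.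
  transitivity (P (ysection (translated_sample @^-1` box A) h)).
    rewrite -[in RHS](setIT (ysection _ _)) -integral_indic//; last exact: measurable_ysection.
    by apply: eq_integral => w _; rewrite !indicE mem_ysection.
  (* Coordinate 0 carries the identity, so it only constrains [h]. *)
  have inE' w : (translated_sample @^-1` box A) (w, h) <->
      A ord0 h /\ forall j, A (lift ord0 j) (Gs j w * h)%g.
    rewrite /box /=; split=> [Awh|[A0 As] i].
      split=> [|j].
        have := Awh ord0.
        by rewrite tnth_mktuple /with_identity unlift_none mul1g.
      by have := Awh (lift ord0 j); rewrite tnth_mktuple /with_identity liftK.
    rewrite tnth_mktuple /with_identity.
    by case: unliftP => [j|] ->; [exact: As|rewrite mul1g].
  rewrite indicE; have [hA|hA] := boolP (h \in A ord0); last first.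
    rewrite mul0e (_ : ysection _ _ = set0) ?measure0//.
    apply/seteqP; split=> w //; rewrite ysectionE /= => /inE'[Ah _].
    by move: hA; rewrite notin_setE.
  rewrite mul1e (_ : ysection _ _ =
      [set w | forall j, A (lift ord0 j) (Gs j w * h)%g]); last first.
    apply/seteqP; split=> w; rewrite ysectionE; first by move=> /inE'[].
    by move=> ?; apply/inE'; split=> //; exact: set_mem.
  rewrite (sample_rectangle (fun j => [set g : borel G | A (lift ord0 j) (g * h : G)%g])).
    by apply: eq_bigr => j _; rewrite haar_right.
  move=> j; rewrite -[X in measurable X]setTI.
  exact: (measurable_fun_pair1 (h : borel G) (measurable_mulg sG)).
rewrite ge0_integralZr//; last 2 first.
- by apply/measurable_EFinP; exact: measurable_indic.
- by apply: prode_ge0 => j _.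
by rewrite integral_indic// setIT big_ord_recl.
Qed.
End translated_sample.

(** * The Monte Carlo e-value *)

Lemma mc_evalue_ratio_to_mean (R : realType) (G : topologicalGroupType)
    (Y : ptopologicalType) (a : continuous_action G Y) (T : Y -> R) (M : nat)
    (g : 'I_M -> G) (y : Y) :
  mc_evalue a T g y = ratio_to_mean (T : borel Y -> R) ord0
    [tuple (a (with_identity g i) y : borel Y) | i < M.+1].
Proof.
rewrite /mc_evalue /ratio_to_mean /mean tnth_mktuple {4}/with_identity unlift_none act1.
by under [in RHS]eq_bigr do rewrite tnth_mktuple.
Qed.

Lemma measurable_act (G : topologicalGroupType) (Y : ptopologicalType)
    (a : continuous_action G Y) (g : G) :
  measurable_fun [set: borel Y] (a g : borel Y -> borel Y).
Proof.
apply: measurable_continuous => y.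
apply: (@continuous_comp _ _ _ (fun y => (g, y)) (fun p : G * Y => a p.1 p.2));
  last exact: act_continuous.
by apply: (@cvg_pair _ _ _ _ (nbhs g) (nbhs y)) => //=; exact: cvg_cst.
Qed.

Lemma measurable_mc_evalue (R : realType) (G : topologicalGroupType)
    (Y : ptopologicalType) (a : continuous_action G Y) (T : Y -> R) (M : nat)
    (g : 'I_M -> G) :
  (forall y, 0 <= T y) -> measurable_fun [set: borel Y] (T : borel Y -> R) ->
  measurable_fun [set: borel Y] (mc_evalue a T g : borel Y -> R).
Proof.
move=> T_ge0 mT.
pose orbit_tuple (y : borel Y) : M.+1.-tuple (borel Y) :=
  [tuple (a (with_identity g i) y : borel Y) | i < M.+1].
have -> : mc_evalue a T g = ratio_to_mean (T : borel Y -> R) ord0 \o orbit_tuple.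
  by apply/funext => y; rewrite mc_evalue_ratio_to_mean.
apply: measurableT_comp; first exact: measurable_ratio_to_mean.
apply/measurable_fun_tnthP => i.
have -> : (fun t => tnth t i) \o orbit_tuple = a (with_identity g i).
  by apply/funext => y /=; rewrite tnth_mktuple.
exact: measurable_act.
Qed.

Theorem theorem4 (R : realType) (G : topologicalGroupType)
    (Y : ptopologicalType) (a : continuous_action G Y)
    (mu : probability (borel G) R) (T : Y -> R) (M : nat)
    (d : measure_display) (Omega : measurableType d) (P : probability Omega R)
    (Gs : 'I_M -> {RV P >-> borel G})
    (hG : lcsch_space G) (hY : lcsch_space Y) (cG : compact [set: G])
    (hmu : haar_probability mu)
    (T_ge0 : forall y, 0 <= T y)
    (mT : measurable_fun [set: borel Y] (T : borel Y -> R))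
    (T_fin : forall y, (0 < 'E_mu[fun g : borel G => T (a g y)] < +oo)%E)
    (hM : (1 <= M)%N)
    (hGs : iid_with_law Gs mu) :
  forall O : set Y, orbit_space a O -> forall y0 : Y, O y0 ->
    (\int[P]_w \int[orbit_unif a mu y0]_y
      (mc_evalue a T (fun i => Gs i w) y)%:E = 1)%E.
Proof.
move=> O _ y0 _; have [sG _ _] := hG.
pose f : borel G -> R := fun g => T (a g y0).
have f_ge0 g : 0 <= f g by exact: T_ge0.
have mf : measurable_fun [set: borel G] f.
  exact: (measurableT_comp mT (measurable_orbit_map a y0)).
have evalueE w (h : borel G) : mc_evalue a T (fun i => Gs i w) (a h y0) =
    ratio_to_mean f ord0 (translated_sample Gs (w, h)).
  rewrite /mc_evalue /ratio_to_mean /mean tnth_mktuple /f /with_identity unlift_none mul1g.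
  have -> : \sum_(j < M.+1) T (a (tnth (translated_sample Gs (w, h)) j) y0) =
      \sum_(i < M.+1) T (a (with_identity (fun j => Gs j w) i) (a h y0)).
    by apply: eq_bigr => i _; rewrite tnth_mktuple actM.
  by [].
transitivity (\int[P]_w \int[mu]_h
    (ratio_to_mean f ord0 (translated_sample Gs (w, h)))%:E)%E.
  apply: eq_integral => w _; rewrite /orbit_unif ge0_integral_distribution/=.
  - by apply: eq_integral => h _; rewrite /= evalueE.
  - apply/measurable_EFinP.
    exact: measurable_mc_evalue.
  - by move=> y; rewrite lee_fin mc_evalue_ratio_to_mean ratio_to_mean_ge0.
transitivity (\int[translated_law mu Gs sG]_t (ratio_to_mean f ord0 t)%:E)%E.
  rewrite integral_translated_law//.
    by apply/measurable_EFinP; exact: measurable_ratio_to_mean.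
  by move=> t; rewrite lee_fin ratio_to_mean_ge0.
apply: integral_ratio_to_mean_exchangeable => // s B mB.
apply: iid_exchangeable mB => A mA; exact: translated_law_box.
Qed.
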